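(* Let $\Pi=\{\pi_n\}$ be a uniform sequence of partitions of $[0,T]$ with vanishing mesh, let $\gamma\in\mathbb{R}$, and let $x\in\mathcal{V}^\gamma_\Pi([0,T];\mathbb{R}^K)$. Let $\lambda=\{\lambda_n\}\subset\mathbb{N}$ be such that the limit of $\Delta_{\lambda,n}:=|\pi_{\lambda_n}|/|\pi_n|$ exists and is not equal to one. Denote the limit by $\Delta_\lambda$. Define for all $n\in\mathbb{N}$ $$\gamma_{\lambda,n}=-\frac{\ln S_{\lambda,n}}{\ln\Delta_{\lambda,n}},\qquad\text{where}\qquad S_{\lambda,n}=\frac{\langle\langle x\rangle\rangle^{(0),\lambda_n}_T}{\langle\langle x\rangle\rangle^{(0),n}_T}.$$ Then, for all $n\in\mathbb{N}$, $$|\gamma-\gamma_{\lambda,n}|\le\frac{2}{|\ln\Delta_{\lambda,n}|}\max_{\tau\in\{n,\lambda_n\}}\frac{\big|\langle\langle x\rangle\rangle^{(\gamma),\tau}_T-\langle\langle x\rangle\rangle^{(\gamma)}_T\big|}{\langle\langle x\rangle\rangle^{(\gamma),\tau}_T\wedge\langle\langle x\rangle\rangle^{(\gamma)}_T}.$$ In particular, $\gamma_{\lambda,n}$ is a consistent estimator of $\gamma$ (i.e. $\gamma_{\lambda,n}\to\gamma$ as $n\to\infty$) and $$\gamma-\gamma_{\lambda,n}=\mathcal{O}_C\Big(\langle\langle x\rangle\rangle^{(\gamma)}_T-\langle\langle x\rangle\rangle^{(\gamma),n}_T\Big),$$ where $C=C(\langle\langle x\rangle\rangle^{(\gamma)}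_T,\Delta_\lambda)$.
   Context: Partitions: a partition $\pi$ of $[0,T]$ is given by $0=t_0<\dots<t_{\#\pi}=T$ and identified with the set of its intervals $[t_i,t_{i+1}]$; $|\pi|$ is its mesh; $\pi\cap[0,t]$ is the set of intervals of $\pi$ contained in $[0,t]$; $\pi$ is uniform if all its intervals have length $|\pi|$; $\{\pi_n\}$ has vanishing mesh if $|\pi_n|\to0$. Scaled variation: with $\delta x_{st}=x_t-x_s$, for $\gamma\in\mathbb{R}$ and scalar paths $x,z$, $\langle x,z\rangle^{(\gamma),n}_t=\sum_{[t_i,t_{i+1}]\in\pi_n\cap[0,t]}(t_{i+1}-t_i)^\gamma\,\delta x_{t_it_{i+1}}\,\delta z_{t_it_{i+1}}$ and $\langle x\rangle^{(\gamma),n}=\langle x,x\rangle^{(\gamma),n}$. $\mathcal{V}^\gamma_\Pi([0,T];\mathbb{R}^K)$ is the set of $x=(x^1,\dots,x^K):[0,T]\to\mathbb{R}^K$ such that for all $i,j$ the limit $\langle x^i,x^j\rangle^{(\gamma)}_t=\lim_n\langle x^i,x^j\rangle^{(\gamma),n}_t$ exists for all $t\in[0,T]$ and is a continuous function of bounded variation in $t$. For $\mathbb{R}^K$-valued $x$, $\langle\langle x\rangle\rangle^{(\gamma),n}=\sum_{i=1}^K\langle x^i\rangle^{(\gamma),n}$ and $\langle\langle x\rangle\rangle^{(\gamma)}=\sum_{i=1}^K\langle x^i,x^i\rangle^{(\gamma)}$. Convention: $a_n=\mathcal{O}_C(b_n)$ with $C=C(q_1,\dots,q_m)$ means that there are a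 finite constant $C$ depending only on $q_1,\dots,q_m$ and an $n_0$ such that $|a_n|\le C\,|b_n|$ for all $n\ge n_0$. $a\wedge b=\min(a,b)$.
   Formalization: Assumes the limit ⟨⟨x⟩⟩^(γ)_T > 0; the bound is for n where γ_{λ,n} is defined; the last display, false as written, has the larger of the errors at n and λ_n on the right, and the original right side (constant C·M) only when the error at λ_n is O_M of that at n (M ≥ 1). *)

(* Defs.v *)
From mathcomp Require Import all_boot all_order all_algebra.
From mathcomp Require Import all_classical all_reals all_analysis.
Import Order.TTheory GRing.Theory Num.Theory.
Import numFieldNormedType.Exports.

Set Implicit Arguments.
Unset Strict Implicit.
Unset Printing Implicit Defensive.

Local Open Scope classical_set_scope.
Local Open Scope ring_scope.

Section ScaledVariation.
Context {R : realType}.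

(* As in [itv_partition], the left end point 0 of [0, T] is not stored:
   0 = t_0 < t_1 < ... < t_m = T is encoded by s = [:: t_1; ...; t_m]. The
   interval [t_i, t_(i+1)] is the pair (t_i, t_(i+1)). *)
Definition intervals (s : seq R) : seq (R * R) := zip (0 :: s) s.

Definition intervals_upto (s : seq R) (t : R) : seq (R * R) :=
  [seq I <- intervals s | (0 <= I.1) && (I.2 <= t)].

Definition mesh (s : seq R) : R :=
  \big[Num.max/0]_(I <- intervals s) (I.2 - I.1).

Definition uniform_partition (T : R) (s : seq R) : Prop :=
  itv_partition 0 T s /\ {in intervals s, forall I, I.2 - I.1 = mesh s}.

Definition vanishing_mesh (Pi : nat -> seq R) : Prop :=
  (fun n => mesh (Pi n)) @ \oo --> (0 : R).

Definition scaled_cov_n (g : R) (Pi : nat -> seq R) (x z : R -> R)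
    (n : nat) (t : R) : R :=
  \sum_(I <- intervals_upto (Pi n) t)
    ((I.2 - I.1) `^ g) * (x I.2 - x I.1) * (z I.2 - z I.1).

Definition scaled_cov (g : R) (Pi : nat -> seq R) (x z : R -> R) (t : R) : R :=
  limn (fun n => scaled_cov_n g Pi x z n t).

Definition coord (K : nat) (x : R -> 'rV[R]_K) (i : 'I_K) (t : R) : R :=
  x t ord0 i.

(* Only the values of x on [0, T] matter. *)
Definition has_scaled_variation (g : R) (Pi : nat -> seq R) (T : R) (K : nat)
    (x : R -> 'rV[R]_K) : Prop :=
  forall i j : 'I_K,
  [/\ forall t, t \in `[0, T] ->
        cvgn (fun n => scaled_cov_n g Pi (coord x i) (coord x j) n t),
      {within `[0, T], continuous (scaled_cov g Pi (coord x i) (coord x j))} &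
      bounded_variation 0 T (scaled_cov g Pi (coord x i) (coord x j))].

Definition total_var_n (g : R) (Pi : nat -> seq R) (K : nat)
    (x : R -> 'rV[R]_K) (n : nat) (t : R) : R :=
  \sum_(i < K) scaled_cov_n g Pi (coord x i) (coord x i) n t.

Definition total_var (g : R) (Pi : nat -> seq R) (K : nat)
    (x : R -> 'rV[R]_K) (t : R) : R :=
  \sum_(i < K) scaled_cov g Pi (coord x i) (coord x i) t.

Definition mesh_ratio (Pi : nat -> seq R) (lam : nat -> nat) (n : nat) : R :=
  mesh (Pi (lam n)) / mesh (Pi n).

Definition var_ratio (Pi : nat -> seq R) (lam : nat -> nat) (T : R) (K : nat)
    (x : R -> 'rV[R]_K) (n : nat) : R :=
  total_var_n 0 Pi x (lam n) T / total_var_n 0 Pi x n T.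

Definition scaling_estimator (Pi : nat -> seq R) (lam : nat -> nat) (T : R)
    (K : nat) (x : R -> 'rV[R]_K) (n : nat) : R :=
  - (ln (var_ratio Pi lam T x n) / ln (mesh_ratio Pi lam n)).

(* ln and _ / _ are total functions here; this says that the ratios in
   [scaling_estimator] and both logarithms are genuine and the denominator
   ln (mesh_ratio Pi lam n) does not vanish. *)
Definition estimator_defined (Pi : nat -> seq R) (lam : nat -> nat) (T : R)
    (K : nat) (x : R -> 'rV[R]_K) (n : nat) : Prop :=
  [/\ 0 < total_var_n 0 Pi x n T, 0 < total_var_n 0 Pi x (lam n) T &
      mesh_ratio Pi lam n != 1].

Definition var_error (g : R) (Pi : nat -> seq R) (T : R) (K : nat)
    (x : R -> 'rV[R]_K) (n : nat) : R :=
  total_var g Pi x T - total_var_n g Pi x n T.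

Definition rel_error (g : R) (Pi : nat -> seq R) (T : R) (K : nat)
    (x : R -> 'rV[R]_K) (n : nat) : R :=
  `|total_var_n g Pi x n T - total_var g Pi x T|
    / Num.min (total_var_n g Pi x n T) (total_var g Pi x T).

(* a_n = O_C(b_n) with the explicit constant C. *)
Definition bigO_cst (C : R) (a b : nat -> R) : Prop :=
  exists n0 : nat, forall n : nat, (n0 <= n)%N -> `|a n| <= C * `|b n|.

End ScaledVariation.

(* Main.v *)
Require Import Defs.
From mathcomp Require Import all_boot all_order all_algebra.
From mathcomp Require Import all_classical all_reals all_analysis.
From mathcomp Require Import ring lra.
Import Order.TTheory GRing.Theory Num.Theory.
Import numFieldNormedType.Exports.

Set Implicit Arguments.
Unset Strict Implicit.
Unset Printing Implicit Defensive.

Local Open Scope classical_set_scope.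
Local Open Scope ring_scope.

(** On a uniform partition every interval has the same length [|pi_n|], so the
    weight [|pi_n|^g] factors out of the scaled variation:
    [V^(g),n = |pi_n|^g V^(0),n], where [V] is the total variation at [T].
    Writing [Delta] for the mesh ratio and [S] for the ratio of unscaled
    variations, this gives [Delta^g S = V^(g),lam n / V^(g),n], and taking
    logarithms turns the estimation error into
    [g - est_n = (ln V^(g),lam n - ln V^(g),n) / ln Delta]
    ([scaling_estimator_error]).  The numerator compares two approximations of
    the same limit [V^(g)]; passing through [ln V^(g)] and using that the
    logarithm is Lipschitz with constant [1 / min a b] between [a] and [b]
    ([ln_dist_le]) yields the pointwise inequality.

    For the asymptotic statements one needs [|ln Delta_n|] bounded away from 0.
    The limit [D] of [Delta_n] may vanish, where [ln D] is not the limit of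
    [ln Delta_n]; the bound [|u - 1| / (1 + u) <= |ln u|] of [ln_norm_ge] has a
    left-hand side continuous at every [D >= 0] and positive for [D != 1], which
    covers all cases at once.  Moreover [lam n] tends to infinity, because the
    meshes are positive while [|pi_(lam n)| = Delta_n |pi_n|] tends to 0
    ([cvgny_of_positive_cvg0]); hence both variations in the numerator converge
    to [V^(g)]. *)

(** * Elementary bounds on the logarithm *)

Lemma ln_le_subr1 (R : realType) (u : R) : 0 < u -> ln u <= u - 1.
Proof.
by move=> u0; rewrite -{1}(subrK 1 u) addrC; apply: le_ln1Dx; lra.
Qed.

(** The mean value bound for [ln], whose derivative on the segment between [a]
    and [b] is at most [1 / min a b]. *)
Lemma ln_dist_le (R : realType) (a b : R) : 0 < a -> 0 < b ->
  `|ln a - ln b| <= `|a - b| / Num.min a b.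
Proof.
wlog ab : a b / a <= b => [wl a0 b0|a0 b0].
  have [ab|/ltW ba] := leP a b; first by have := wl a b ab a0 b0; rewrite min_l.
  by have := wl b a ba b0 a0; rewrite distrC (distrC b) min_l.
rewrite min_l// distrC (distrC a) -ln_div ?posrE//.
have ba1 : 1 <= b / a by rewrite ler_pdivlMr// mul1r.
rewrite !ger0_norm ?subr_ge0 ?ln_ge0//.
have := @ln_le_subr1 R (b / a) (divr_gt0 b0 a0).
by rewrite mulrBl divff// gt_eqF.
Qed.

(** Both [1 - 1/u <= ln u] and [ln u <= u - 1] contribute: on either side of 1
    one of them bounds [|ln u|] below by [|u - 1| / max 1 u]. *)
Lemma ln_norm_ge (R : realType) (u : R) : 0 < u ->
  `|u - 1| / (1 + u) <= `|ln u|.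
Proof.
move=> u0; rewrite ler_pdivrMr; last lra.
have [u1|u1] := leP u 1.
  rewrite ler0_norm ?subr_le0// ler0_norm ?ln_le0//.
  have := @ln_le_subr1 R u u0; have := @ln_le0 R u u1; nra.
have lnu : 0 <= ln u by rewrite ln_ge0// ltW.
rewrite !ger0_norm ?subr_ge0 ?(ltW u1)//.
have := @ln_le_subr1 R u^-1; rewrite invr_gt0 lnV ?posrE// => /(_ u0) h.
have := mulVf (lt0r_neq0 u0); set v := u^-1 in h *; nra.
Qed.

(** * Uniform partitions *)

Section Uniform.
Variables (R : realType) (T : R).
Hypothesis T0 : 0 < T.

Lemma uniform_partition_mesh_gt0 (s : seq R) :
  uniform_partition T s -> 0 < mesh s.
Proof.
case: s => [|t s] [[/= pth /eqP lst] unif].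
  by move: T0; rewrite -lst ltxx.
rewrite -(unif (0, t)) /intervals ?mem_head//= subr0.
by case/andP: pth.
Qed.

Lemma scaled_cov_n_uniform (g : R) (Pi : nat -> seq R) (x z : R -> R) n t :
  uniform_partition T (Pi n) ->
  scaled_cov_n g Pi x z n t = mesh (Pi n) `^ g * scaled_cov_n 0 Pi x z n t.
Proof.
move=> [_ unif]; rewrite /scaled_cov_n big_distrr/=.
apply: eq_big_seq => I; rewrite mem_filter => /andP[_ /unif ->].
by rewrite powRr0 mul1r mulrA.
Qed.

Lemma total_var_n_uniform (g : R) (Pi : nat -> seq R) K (x : R -> 'rV[R]_K) n t :
  uniform_partition T (Pi n) ->
  total_var_n g Pi x n t = mesh (Pi n) `^ g * total_var_n 0 Pi x n t.
Proof.
move=> unif; rewrite /total_var_n big_distrr/=.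
by apply: eq_bigr => i _; exact: scaled_cov_n_uniform.
Qed.

Variables (Pi : nat -> seq R) (lam : nat -> nat) (g : R) (K : nat).
Variable x : R -> 'rV[R]_K.
Hypothesis unif : forall n, uniform_partition T (Pi n).

Let mesh_gt0 n : 0 < mesh (Pi n).
Proof. exact: uniform_partition_mesh_gt0. Qed.

Lemma mesh_ratio_gt0 n : 0 < mesh_ratio Pi lam n.
Proof. by rewrite divr_gt0. Qed.

Lemma total_var_n_gt0 n :
  (0 < total_var_n g Pi x n T) = (0 < total_var_n 0 Pi x n T).
Proof. by rewrite total_var_n_uniform// pmulr_rgt0// powR_gt0. Qed.

(** The powers of the two meshes contribute exactly [g * ln Delta] to the
    difference of the logarithms. *)
Lemma scaling_estimator_error n : estimator_defined Pi lam T x n ->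
  g - scaling_estimator Pi lam T x n =
  (ln (total_var_n g Pi x (lam n) T) - ln (total_var_n g Pi x n T))
    / ln (mesh_ratio Pi lam n).
Proof.
move=> [V0 Vl0 D1].
have lnD : ln (mesh_ratio Pi lam n) != 0.
  by rewrite ln_eq0 ?mesh_ratio_gt0.
rewrite /scaling_estimator opprK !(@total_var_n_uniform g)//.
rewrite -{1}(mulfK lnD g) -mulrDl; congr (_ / _).
rewrite /var_ratio /mesh_ratio !ln_div ?posrE//.
by rewrite !lnM ?posrE ?powR_gt0// !ln_powR; ring.
Qed.

Hypothesis V_gt0 : 0 < total_var g Pi x T.

(** The two logarithms are compared through the logarithm of their common
    limit; the factor 2 bounds the sum of the two errors by their maximum. *)
Lemma scaling_estimator_dist_le n : estimator_defined Pi lam T x n ->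
  `|g - scaling_estimator Pi lam T x n| <=
    2 / `|ln (mesh_ratio Pi lam n)|
    * Num.max (rel_error g Pi T x n) (rel_error g Pi T x (lam n)).
Proof.
move=> def; have [V0 Vl0 _] := def.
rewrite scaling_estimator_error// normrM normfV mulrAC.
apply: ler_wpM2r; first by rewrite invr_ge0.
rewrite -total_var_n_gt0 in V0; rewrite -total_var_n_gt0 in Vl0.
have := @ln_dist_le R _ _ V0 V_gt0; have := @ln_dist_le R _ _ Vl0 V_gt0.
rewrite -/(rel_error g Pi T x n) -/(rel_error g Pi T x (lam n)).
set r := rel_error _ _ _ _ n; set r' := rel_error _ _ _ _ (lam n).
set v := ln (total_var _ _ _ _) => hl hn.
have -> : ln (total_var_n g Pi x (lam n) T) - ln (total_var_n g Pi x n T) =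
  (ln (total_var_n g Pi x (lam n) T) - v) - (ln (total_var_n g Pi x n T) - v).
  by ring.
apply: (le_trans (ler_normB _ _)).
have rm : r <= Num.max r r' by rewrite le_max lexx.
have rm' : r' <= Num.max r r' by rewrite le_max lexx orbT.
by lra.
Qed.

End Uniform.

(** * Limits *)

(** A sequence of indices cannot visit any fixed [N] infinitely often, since
    the values stay below the positive number [u N] from some rank on. *)
Lemma cvgny_of_positive_cvg0 (R : realType) (u : nat -> R) (lam : nat -> nat) :
  (forall n, 0 < u n) -> u (lam n) @[n --> \oo] --> 0 ->
  lam n @[n --> \oo] --> \oo.
Proof.
move=> u0 cvg0; apply/cvgnyPge; elim=> [|N IH]; first by near=> n.
near=> n; rewrite ltn_neqAle; apply/andP; split; last by near: n.
apply/eqP => Nlam; have : u (lam n) < u N.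
  by near: n; exact: (cvgr_lt 0).
by rewrite Nlam ltxx.
Unshelve. all: by end_near. Qed.

Lemma cvg_total_var_n (R : realType) (T g : R) (Pi : nat -> seq R) (K : nat)
    (x : R -> 'rV[R]_K) : 0 < T -> has_scaled_variation g Pi T x ->
  total_var_n g Pi x n T @[n --> \oo] --> total_var g Pi x T.
Proof.
move=> T0 hx.
rewrite /total_var /total_var_n; apply: cvg_big => [|i _].
  exact: add_continuous.
by have [cvg_i _ _] := hx i i; apply: cvg_i; rewrite in_itv/= lexx ltW.
Qed.

(** * The estimator *)

(** The three factors of the constant: [ln_norm_ge] gives
    [2 / |ln Delta_n| <= 2 * 2 (1 + D) / |D - 1|] once [|Delta_n - 1| /
    (1 + Delta_n)] exceeds half its limit, and [min V_n V >= V / 2] turns the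
    relative errors into [2 / V] times the absolute ones. *)
Lemma scaling_estimator_near_le (R : realType) (T : R) (K : nat)
    (Pi : nat -> seq R) (g : R) (x : R -> 'rV[R]_K) (lam : nat -> nat) (D : R) :
  0 < T -> (forall n, uniform_partition T (Pi n)) ->
  0 < total_var g Pi x T ->
  total_var_n g Pi x n T @[n --> \oo] --> total_var g Pi x T ->
  total_var_n g Pi x (lam n) T @[n --> \oo] --> total_var g Pi x T ->
  mesh_ratio Pi lam @ \oo --> D -> 0 <= D -> D != 1 ->
  \forall n \near \oo, `|g - scaling_estimator Pi lam T x n| <=
    8 * (1 + D) / (total_var g Pi x T * `|D - 1|)
    * Num.max `|var_error g Pi T x n| `|var_error g Pi T x (lam n)|.
Proof.
move=> T0 unif V0 limVn limVln limD D0 D1.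
set V := total_var _ _ _ _ in V0 limVn limVln *.
have V2 : V / 2 < V by lra.
have D1_gt0 : 0 < `|D - 1| by rewrite normr_gt0 subr_eq0.
have c0 : 0 < `|D - 1| / (1 + D) by rewrite divr_gt0//; lra.
have cvgc : `|mesh_ratio Pi lam n - 1| / (1 + mesh_ratio Pi lam n)
    @[n --> \oo] --> `|D - 1| / (1 + D).
  apply: cvgM.
    by apply: cvg_norm; apply: cvgB; [exact: limD|exact: cvg_cst].
  apply: cvgV; first by apply: lt0r_neq0; lra.
  by apply: cvgD; [exact: cvg_cst|exact: limD].
near=> n.
have Vn : V / 2 < total_var_n g Pi x n T by near: n; exact: (cvgr_gt V).
have Vln : V / 2 < total_var_n g Pi x (lam n) T.
  by near: n; exact: (cvgr_gt V).
have lnD : `|D - 1| / (1 + D) / 2 < `|ln (mesh_ratio Pi lam n)|.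
  apply: (@lt_le_trans _ _ (`|mesh_ratio Pi lam n - 1|
                            / (1 + mesh_ratio Pi lam n))).
    by near: n; apply: (cvgr_gt (`|D - 1| / (1 + D))) => //; lra.
  by apply: ln_norm_ge; exact: (mesh_ratio_gt0 T0).
have def : estimator_defined Pi lam T x n.
  split; last first.
  - by apply/eqP => E; move: lnD; rewrite E ln1 normr0; lra.
  - by rewrite -(total_var_n_gt0 T0 g _ unif); lra.
  - by rewrite -(total_var_n_gt0 T0 g _ unif); lra.
apply: (le_trans (scaling_estimator_dist_le T0 unif V0 def)).
have rel_le m : V / 2 < total_var_n g Pi x m T ->
    rel_error g Pi T x m <= 2 / V * `|var_error g Pi T x m|.
  move=> Vm; rewrite /rel_error /var_error distrC mulrC.
  apply: ler_wpM2r => //; rewrite -[2 / V]invf_div lef_pV2 ?posrE.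
  - by rewrite le_min !ltW.
  - by rewrite lt_min; apply/andP; split; rewrite -/V; lra.
  - by lra.
set m := Num.max `|_| `|_|.
have maxr_le : Num.max (rel_error g Pi T x n) (rel_error g Pi T x (lam n))
    <= 2 / V * m.
  have V2_ge0 : 0 <= 2 / V by rewrite divr_ge0// ltW.
  rewrite ge_max; apply/andP; split; apply: (le_trans (rel_le _ _)) => //;
    by apply: ler_wpM2l => //; rewrite le_max lexx ?orbT.
have -> : 8 * (1 + D) / (V * `|D - 1|) * m
    = 2 / (`|D - 1| / (1 + D) / 2) * (2 / V * m).
  by field; rewrite !lt0r_neq0//; lra.
apply: ler_pM => //.
- have Vmin : 0 < Num.min (total_var_n g Pi x n T) V.
    by rewrite lt_min; apply/andP; split; lra.
  by rewrite le_max /rel_error divr_ge0// ltW.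
- have c2 : 0 < `|D - 1| / (1 + D) / 2 by rewrite divr_gt0.
  by rewrite ler_pM2l// lef_pV2 ?posrE ?(ltW lnD)// (lt_trans c2).
Unshelve. all: by end_near. Qed.

Theorem theorem3p9 (R : realType) :
  exists C : R -> R -> R,
  forall (T : R) (K : nat) (Pi : nat -> seq R) (g : R) (x : R -> 'rV[R]_K)
    (lam : nat -> nat) (Dlam : R),
    0 < T ->
    (forall n, uniform_partition T (Pi n)) ->
    vanishing_mesh Pi ->
    has_scaled_variation g Pi T x ->
    0 < total_var g Pi x T ->
    mesh_ratio Pi lam @ \oo --> Dlam ->
    Dlam != 1 ->
    [/\ forall n, estimator_defined Pi lam T x n ->
          `|g - scaling_estimator Pi lam T x n| <=
            2 / `|ln (mesh_ratio Pi lam n)|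
            * Num.max (rel_error g Pi T x n) (rel_error g Pi T x (lam n)),
        scaling_estimator Pi lam T x @ \oo --> g,
        bigO_cst (C (total_var g Pi x T) Dlam)
          (fun n => g - scaling_estimator Pi lam T x n)
          (fun n => Num.max `|var_error g Pi T x n|
                            `|var_error g Pi T x (lam n)|)
      & forall M : R, 1 <= M ->
          bigO_cst M (fun n => var_error g Pi T x (lam n))
            (var_error g Pi T x) ->
          bigO_cst (C (total_var g Pi x T) Dlam * M)
            (fun n => g - scaling_estimator Pi lam T x n)
            (var_error g Pi T x)].
Proof.
exists (fun V D => 8 * (1 + D) / (V * `|D - 1|)).
move=> T K Pi g x lam D T0 unif mesh0 hx V0 cvgD D1.
have mesh_gt0 n : 0 < mesh (Pi n) by exact: (uniform_partition_mesh_gt0 T0).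
have D0 : 0 <= D.
  rewrite -(cvg_lim _ cvgD)//; apply: limr_ge; first by apply/cvg_ex; exists D.
  by near=> n; exact/ltW/(mesh_ratio_gt0 T0).
have lam_cvg : lam n @[n --> \oo] --> \oo.
  apply: (@cvgny_of_positive_cvg0 R (fun n => mesh (Pi n))) => //.
  have -> : (fun n => mesh (Pi (lam n)))
      = mesh_ratio Pi lam \* (fun n => mesh (Pi n)).
    by apply/funext => n; rewrite /mesh_ratio /= divfK ?lt0r_neq0.
  by have := cvgM cvgD mesh0; rewrite mulr0; exact.
have cvgVn := cvg_total_var_n T0 hx.
have cvgVln : total_var_n g Pi x (lam n) T @[n --> \oo] --> total_var g Pi x T.
  exact: (cvg_comp lam _ lam_cvg cvgVn).
have near_le := scaling_estimator_near_le T0 unif V0 cvgVn cvgVln cvgD D0 D1.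
set C := 8 * (1 + D) / _ in near_le *.
have C0 : 0 < C.
  by rewrite divr_gt0 ?mulr_gt0 ?normr_gt0 ?subr_eq0//; lra.
split.
- by move=> n; exact: scaling_estimator_dist_le.
- apply/cvgrPdist_lt => e e0; near=> n.
  apply: (@le_lt_trans _ _ (C * Num.max `|var_error g Pi T x n|
                                        `|var_error g Pi T x (lam n)|)).
    by near: n.
  rewrite mulrC -ltr_pdivlMr// gt_max; apply/andP; split; near: n.
  + by move/cvgrPdist_lt : cvgVn; apply; exact: divr_gt0.
  + by move/cvgrPdist_lt : cvgVln; apply; exact: divr_gt0.
- case: near_le => N _ near_le; exists N => n /near_le.
  by rewrite [X in _ -> _ <= _ * X]ger0_norm// le_max normr_ge0.
- move=> M M1 [N1 err_le]; case: near_le => N _ near_le.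
  exists (maxn N N1) => n; rewrite geq_max => /andP[/near_le h /err_le h1].
  apply: (le_trans h); rewrite -mulrA ler_pM2l// ge_max h1 andbT.
  by rewrite ler_peMl.
Unshelve. all: by end_near. Qed.
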